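(* Let $\alpha\ge-1/2$ and $\nu,\mu\in\mathbb{R}$. Let $f:\mathbb{R}_+\to\mathbb{C}$ be such that $t^\nu f(t)\in L^1(0,1)$ and $t^{\nu-\alpha-1/2}f(t)\in L^1(1,\infty)$. Then $\mathcal{L}^{\alpha}_{\nu,\mu}f(r)$ converges for every $r>0$. Moreover: 1. If $\mu+\nu-\alpha-1/2<0$, then $\mathcal{L}^{\alpha}_{\nu,\mu}f$ converges uniformly on any interval $[\varepsilon,\infty)$ with $\varepsilon>0$. 2. If $\mu+\nu-\alpha-1/2>0$, then $\mathcal{L}^{\alpha}_{\nu,\mu}f$ converges uniformly on any interval $[0,\varepsilon]$ with $\varepsilon>0$. 3. If $\mu+\nu-\alpha-1/2=0$, then $\mathcal{L}^{\alpha}_{\nu,\mu}f$ converges uniformly on $\mathbb{R}_+$.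
   Context: $\mathbb{R}_+=[0,\infty)$. For $\alpha\ge-1/2$, $j_\alpha(z)=\Gamma(\alpha+1)(z/2)^{-\alpha}J_\alpha(z)$ is the normalized Bessel function, where $J_\alpha$ is the Bessel function of the first kind of order $\alpha$ (so $j_\alpha(0)=1$). Standing assumption: $f:\mathbb{R}_+\to\mathbb{C}$ is locally of bounded variation and locally integrable on $(0,\infty)$. The transform is $\mathcal{L}^{\alpha}_{\nu,\mu}f(r)=r^\mu\int_0^\infty (rt)^\nu f(t)j_\alpha(rt)\,dt$, where $\int_0^\infty=\lim_{N\to\infty}\int_0^N$ (convergence at $r$ means that this limit exists and is finite) and $r^\mu(rt)^\nu$ is read as $r^{\mu+\nu}t^\nu$ (at $r=0$ the factor $r^{\mu+\nu}$ is $1$ if $\mu+\nu=0$, $0$ if $\mu+\nu>0$, and undefined if $\mu+\nu<0$). It converges uniformly on a set $E\subset\mathbb{R}_+$ if the partial integrals $r^{\mu}\int_0^N (rt)^\nu f(t)j_\alpha(rt)\,dt$ converge uniformly in $r\in E$ as $N\to\infty$, equivalently $r^{\mu}\int_M^N (rt)^\nu f(t)j_\alpha(rt)\,dt\to0$ uniformly in $r\in E$ as $N>M\to\infty$. *)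

(* Defs.v *)
From HB Require Import structures.
From mathcomp Require Import all_boot all_order all_algebra.
From mathcomp Require Import all_classical all_reals all_analysis.
From mathcomp.real_closed Require Import complex.

Set Implicit Arguments.
Unset Strict Implicit.
Unset Printing Implicit Defensive.

Import Order.TTheory GRing.Theory Num.Theory.
Import numFieldNormedType.Exports.

Local Open Scope classical_set_scope.
Local Open Scope ring_scope.
Local Open Scope complex_scope.

Local Notation normc := ComplexField.Normc.normc.

Section ComplexValued.
Context {R : realType}.
Implicit Types (D : set R) (g : R -> R[i]) (a b : R).

(* Measurability of a complex function is that of its two components, since
   R[i] carries no measurable structure in the library. *)
Definition L1 D g : Prop :=
  [/\ measurable_fun D (fun t => complex.Re (g t)),
      measurable_fun D (fun t => complex.Im (g t)) &
      (\int[lebesgue_measure]_(t in D) (normc (g t))%:E < +oo)%E].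

Definition cintegral D g : R[i] :=
  (\int[lebesgue_measure]_(t in D) complex.Re (g t))
  +i* (\int[lebesgue_measure]_(t in D) complex.Im (g t)).

(* Same shape as [variation] and [bounded_variation] in the library, which are
   restricted to real-valued functions. *)
Definition cvariation a b g (s : seq R) : R :=
  let G := g \o nth b (a :: s) in
  \sum_(0 <= k < size s) normc (G k.+1 - G k).

Definition cbounded_variation a b g : Prop :=
  has_ubound [set cvariation a b g s | s in itv_partition a b].

Definition locally_BV g : Prop :=
  forall a b, 0 < a -> a < b -> cbounded_variation a b g.

Definition locally_L1 g : Prop :=
  forall a b, 0 < a -> a < b -> L1 `[a, b] g.

End ComplexValued.

Section Bessel.
Context {R : realType}.
Implicit Types (alpha a z : R).

(* Euler's integral; it converges for 0 < a, which covers every use below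
   when -1 < alpha. *)
Definition Gamma a : R :=
  \int[lebesgue_measure]_(t in `]0, +oo[) (t `^ (a - 1) * expR (- t)).

(* Bessel function of the first kind, for 0 < z and -1 < alpha. *)
Definition besselJ alpha z : R :=
  limn [series (-1) ^+ k / (k`!%:R * Gamma (k%:R + alpha + 1))
                * (z / 2) `^ (2 * k%:R + alpha)]_k.

(* The value at 0 is the continuous extension. *)
Definition bessel_j alpha z : R :=
  if z == 0 then 1
  else Gamma (alpha + 1) * (z / 2) `^ (- alpha) * besselJ alpha z.

End Bessel.

Section Transform.
Context {R : realType}.
Variables (alpha nu mu : R) (f : R -> R[i]).
Implicit Types (r t N : R) (E : set R).

Definition integrand r t : R[i] := (t `^ nu * bessel_j alpha (r * t))%:C * f t.

(* r^mu (r t)^nu is read as r^(mu + nu) t^nu. At r = 0, [powR] gives 1 if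
   mu + nu = 0 and 0 if 0 < mu + nu; its value 0 for mu + nu < 0 is junk.
   The type R[i]^o provides the usual topology of the complex plane. *)
Definition partial_transform N r : R[i]^o :=
  (r `^ (mu + nu))%:C * cintegral `]0, N[ (integrand r).

Definition transform r : R[i]^o :=
  lim (partial_transform N r @[N --> +oo]).

(* The [L1] conjuncts below say that the integrals from 0 to N are defined,
   as [cintegral] is total. *)
Definition transform_converges_at r : Prop :=
  (forall N, 0 < N -> L1 `]0, N[ (integrand r)) /\
  cvg (partial_transform N r @[N --> +oo]).

Definition transform_converges_uniformly_on E : Prop :=
  (forall r N, E r -> 0 < N -> L1 `]0, N[ (integrand r)) /\
  {uniform E, partial_transform N @[N --> +oo] --> transform}.

End Transform.

(* Main.v *)
(* Up to the factor [z^(alpha + 1/2)], the Bessel function solves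
   [u'' + (1 - (alpha^2 - 1/4) / z^2) u = 0], whose energy [u'^2 + u^2] has
   logarithmic derivative [O(z^-2)] and is therefore bounded for [z >= 1].
   Hence [|j_alpha z| <= C min(1, z^(-alpha-1/2))], and the part of the
   transform beyond [N] is at most [C r^(mu+nu-alpha-1/2)] times the tail of the
   convergent integral of [t^(nu-alpha-1/2) |f t|]; the three cases are those
   where this power of [r] is bounded. The equation for [j_alpha] comes from the
   recurrence of its power series, that is, from [Gamma (a + 1) = a Gamma a]. *)
Require Import Defs.
From HB Require Import structures.
From mathcomp Require Import all_boot all_order all_algebra.
From mathcomp Require Import all_classical all_reals all_analysis.
From mathcomp.real_closed Require Import complex.
From mathcomp Require Import measurable_realfun ring lra.

Import Order.TTheory GRing.Theory Num.Theory.
Import numFieldNormedType.Exports.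

Local Open Scope classical_set_scope.
Local Open Scope ring_scope.
Local Open Scope complex_scope.

Local Notation normc := ComplexField.Normc.normc.

(** * Euler's Gamma integral: functional equation, finiteness and positivity *)

Section GammaFunction.
Context {R : realType}.
Implicit Types a x y t : R.
Local Notation mu := (@lebesgue_measure R).
Local Notation Rpos := [set` `]0%R, +oo[%R].

(** Kept in the extended reals so that the functional equation needs no finiteness and can serve to
    prove it. *)
Definition eGamma a : \bar R :=
  (\int[mu]_(t in Rpos) (t `^ (a - 1) * expR (- t))%:E)%E.

Lemma GammaE a : Gamma a = fine (eGamma a).
Proof. by []. Qed.

Lemma measurable_Gamma_integrand a (D : set R) :
  measurable_fun D (fun t => t `^ a * expR (- t)).
Proof.
apply: measurable_funM.
  by apply: measurable_funTS; exact: measurable_powR.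
apply: measurable_funTS; apply: measurableT_comp => //.
Qed.

Lemma emeasurable_Gamma_integrand a (D : set R) :
  measurable_fun D (EFin \o (fun t => t `^ a * expR (- t))).
Proof. by apply/measurable_EFinP; exact: measurable_Gamma_integrand. Qed.

Lemma eGamma_ge0 a : (0 <= eGamma a)%E.
Proof.
apply: integral_ge0 => t _.
by rewrite lee_fin mulr_ge0 ?powR_ge0 ?expR_ge0.
Qed.

Lemma derivable_LRcontinuous (F : R -> R) x y :
  (forall t, x <= t <= y -> derivable F t 1) -> x < y ->
  derivable_oo_LRcontinuous F x y.
Proof.
move=> dF xy.
have cF t : x <= t <= y -> {for t, continuous F}.
  by move=> ?; apply: differentiable_continuous; apply/derivable1_diffP/dF.
split.
- by move=> t; rewrite in_itv/= => /andP[/ltW ? /ltW ?]; apply/dF/andP.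
- by apply: cvg_at_right_filter; apply: cF; rewrite lexx ltW.
- by apply: cvg_at_left_filter; apply: cF; rewrite lexx ltW.
Qed.

Lemma powR_continuous a x : 0 < x -> {for x, continuous (@powR R ^~ a)}.
Proof.
move=> x0; apply: differentiable_continuous; apply/derivable1_diffP.
by apply: derivable_powR; rewrite in_itv/= x0.
Qed.

Lemma Gamma_integrand_within a x y : 0 < x ->
  {within `[x, y], continuous (fun t => t `^ a * expR (- t))}.
Proof.
move=> x0; apply: continuous_in_subspaceT => t; rewrite inE/= in_itv/=.
move=> /andP[xt _]; apply: (@continuousM R R (@powR R ^~ a) (fun t => expR (- t))).
  by apply: powR_continuous; rewrite (lt_le_trans x0).
by apply: continuous_comp; [exact: opp_continuous|exact: continuous_expR].
Qed.

Lemma integrable_Gamma_integrand a x y : 0 < x ->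
  mu.-integrable `[x, y] (EFin \o (fun t => t `^ a * expR (- t))).
Proof.
move=> x0; apply: continuous_compact_integrable.
  exact: segment_compact.
exact: Gamma_integrand_within.
Qed.

(** Stated away from 0, where [t^a] is differentiable for every real [a]; the boundary terms
    disappear only in the limit. *)
Lemma Gamma_by_parts a x y : 0 < x -> x < y ->
  (\int[mu]_(t in `[x, y]) (t `^ a * expR (- t))%:E =
  (x `^ a * expR (- x) - y `^ a * expR (- y))%:E
  + a%:E * \int[mu]_(t in `[x, y]) (t `^ (a - 1) * expR (- t))%:E)%E.
Proof.
move=> x0 xy.
have dP t : x <= t <= y -> derivable (@powR R ^~ a) t 1.
  move=> /andP[xt _]; apply: derivable_powR.
  by rewrite in_itv/= (lt_le_trans x0).
have dE t : is_derive t 1 (fun t : R => - expR (- t)) (expR (- t)).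
  apply: is_derive_eq; rewrite -[in RHS](opprK (expR _)) -mulN1r -mulN1r/=.
  by rewrite /GRing.scale/=; ring.
rewrite (@integration_by_parts _ (@powR R ^~ a) (fun t => - expR (- t))
  (fun t => a * t `^ (a - 1)) (fun t => expR (- t))) //.
- rewrite (_ : y `^ a * - expR (- y) - x `^ a * - expR (- x) =
    x `^ a * expR (- x) - y `^ a * expR (- y)); last by ring.
  congr (_ + _)%E.
  rewrite -[in RHS](opprK a) EFinN mulNe -integralZl//; last first.
    exact: integrable_Gamma_integrand.
  congr (- _)%E; apply: eq_integral => t _.
  by rewrite -EFinM mulrN mulNr mulrA opprK.
- apply: continuous_in_subspaceT => t; rewrite inE/= in_itv/= => /andP[xt _].
  apply: (@continuousM R R (cst a) (@powR R ^~ (a - 1))); first exact: cst_continuous.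
  by apply: powR_continuous; rewrite (lt_le_trans x0).
- exact: derivable_LRcontinuous.
- move=> t; rewrite in_itv/= => /andP[xt _].
  by rewrite powR_derive1// in_itv/= (lt_trans x0).
- apply: continuous_subspaceT => t.
  by apply: continuous_comp; [exact: opp_continuous|exact: continuous_expR].
- by apply: derivable_LRcontinuous; [move=> t _; have [] := dE t|exact: xy].
- by move=> t _; rewrite derive1E; exact: derive_val.
Qed.

Lemma powR_expRN_cvgy a : x `^ a * expR (- x) @[x --> +oo] --> (0 : R).
Proof.
(* For [x >= 1] and [m >= a], the term [x^(m+1) / (m+1)!] of the exponential series gives
   [x^a exp(-x) <= (m+1)! / x]. *)
pose m := (Num.truncn `|a|).+1.
have am : a <= m%:R by rewrite (le_trans (ler_norm _))// ltW// truncnS_gt.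
apply: (@squeeze_cvgr _ _ _ _ (cst 0) (fun x => m.+1`!%:R * x^-1)).
- near=> x.
  have x1 : 1 <= x by [].
  have x0 : 0 < x by exact: lt_le_trans x1.
  rewrite mulr_ge0 ?powR_ge0 ?expR_ge0//= expRN.
  rewrite ler_pdivrMr ?expR_gt0// mulrAC ler_pdivlMr//.
  apply: (@le_trans _ _ (x ^+ m.+1)).
    by rewrite exprSr ler_wpM2r ?(ltW x0)// -powR_mulrn ?(ltW x0)// ler_powR.
  rewrite mulrC -ler_pdivrMr ?ltr0n ?fact_gt0//.
  by apply: le_trans (expR_ge1Dxn m (ltW x0)); rewrite lerDr.
- exact: cvg_cst.
- rewrite -(mulr0 (m.+1`!%:R)); apply: cvgM; [exact: cvg_cst|].
  by apply/gtr0_cvgV0; [near=> x|exact: cvg_id].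
Unshelve. all: end_near. Qed.

Lemma Gamma_boundary_cvg a : 0 < a ->
  (n.+2%:R^-1 : R) `^ a * expR (- n.+2%:R^-1)
   - n.+2%:R `^ a * expR (- n.+2%:R) @[n --> \oo] --> (0 : R).
Proof.
move=> a0; rewrite -[X in _ --> X](subr0 0); apply: cvgB.
  have u0 : (n.+2%:R^-1 : R) @[n --> \oo] --> (0 : R).
    by have := @cvg_harmonic R; rewrite -(cvg_shiftS _).
  apply: (@squeeze_cvgr _ _ _ _ (cst 0) (fun n => (n.+2%:R^-1 : R) `^ a)).
  - apply: nearW => n; rewrite mulr_ge0 ?powR_ge0 ?expR_ge0//=.
    by rewrite ler_piMr ?powR_ge0// expR_le1 oppr_le0.
  - exact: cvg_cst.
  - have /cvg_at_rightP := @powR_cvg0 R a a0.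
    by apply; split => // n; rewrite invr_gt0.
have /cvg_pinftyP/(_ (fun n => n.+2%:R)) := powR_expRN_cvgy a; apply.
by have := @cvgr_idn R; rewrite -(cvg_shiftn 2); under eq_fun do rewrite addn2.
Qed.

Lemma eGammaS a : 0 < a -> eGamma (a + 1) = (a%:E * eGamma a)%E.
Proof.
move=> a0.
(* Exhaustion of the half-line for monotone convergence. The shift by 2 makes the endpoints distinct
   already at [n = 0], as integration by parts requires. *)
pose F n : set R := [set` `[(n.+2%:R)^-1, n.+2%:R]].
have UF : \bigcup_n F n = Rpos.
  apply/seteqP; split => [t [n _]|t]; rewrite /F/= !in_itv/= andbT.
    by move=> /andP[+ _]; apply: lt_le_trans; rewrite invr_gt0.
  move=> t0; exists (maxn (Num.truncn t) (Num.truncn t^-1)) => //=.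
  rewrite in_itv/= invf_ple// ?posrE//; apply/andP; split.
    rewrite (le_trans (ltW (truncnS_gt _)))// ler_nat ltnS ltnW// ltnS.
    exact: leq_maxr.
  rewrite (le_trans (ltW (truncnS_gt _)))// ler_nat ltnS ltnW// ltnS.
  exact: leq_maxl.
have ndF : nondecreasing_seq F.
  move=> m n mn; rewrite subsetEset /F; apply: subset_itv; rewrite bnd_simp.
    by rewrite lef_pV2 ?posrE// ler_nat !ltnS.
  by rewrite ler_nat !ltnS.
have cvgF b : (\int[mu]_(t in F n) (t `^ (b - 1) * expR (- t))%:E)%E
    @[n --> \oo] --> eGamma b.
  rewrite /eGamma -UF; apply: ge0_nondecreasing_set_cvg_integral => //.
  - by move=> n; exact: measurable_itv.
  - by move=> n; apply/measurable_EFinP; exact: measurable_Gamma_integrand.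
  - by move=> n t _; rewrite lee_fin mulr_ge0 ?powR_ge0 ?expR_ge0.
have /cvg_lim <-// := cvgF (a + 1).
apply/cvg_lim => //.
under eq_fun => n.
  rewrite addrK Gamma_by_parts; last 2 first.
  - by rewrite invr_gt0.
  - by apply: (@lt_trans _ _ 1); rewrite ?invf_lt1 ?ltr1n.
  over.
rewrite -[(a%:E * eGamma a)%E]add0e; apply: cvgeD => //.
- by apply: cvg_EFin; [exact: nearW|exact: Gamma_boundary_cvg].
- by apply: cvgeZl => //; exact: cvgF.
Qed.

(** This is the total mass of the exponential distribution of rate 1. *)
Lemma eGamma1 : eGamma 1 = 1%E.
Proof.
rewrite -(@integral_exponential_pdf R 1)// /eGamma integral_itv_obnd_cbnd; last first.
  exact: emeasurable_Gamma_integrand.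
rewrite integral_mkcond; apply: eq_integral => t _.
rewrite restrict_EFin /exponential_pdf /= !patchE; case: ifP => // _.
by rewrite subrr powRr0 !mul1r mulN1r.
Qed.

Lemma eGamma_lty a : 0 < a -> (eGamma a < +oo)%E.
Proof.
(* For [0 < a], finiteness of [eGamma (a + 1) = a * eGamma a] passes back to [eGamma a]. *)
suff h b : 1 <= b -> (eGamma b < +oo)%E.
  move=> a0; have := h (a + 1); rewrite lerDr (ltW a0) => /(_ isT).
  rewrite eGammaS//; case: (eGamma a) (eGamma_ge0 a) => [r _|_|//].
    by move=> _; exact: ltry.
  by rewrite mulry gtr0_sg ?mul1e.
have gn n : (eGamma n.+1%:R < +oo)%E.
  elim: n => [|n IH]; first by rewrite eGamma1 ltry.
  rewrite -natr1 eGammaS// -ge0_fin_numE; last first.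
    by rewrite mule_ge0 ?eGamma_ge0.
  by rewrite fin_numM// ge0_fin_numE ?eGamma_ge0.
move=> b1.
pose m := Num.truncn b.
have bm : b - 1 <= m%:R.
  by rewrite lerBlDr natr1 ltW// truncnS_gt.
(* The power [t^(b-1)] is at most [1] for [t <= 1] and at most [t^m] for [t >= 1], hence at most
   [1 + t^m]; integer arguments are settled by induction. *)
apply: (@le_lt_trans _ _ (eGamma 1 + eGamma m.+1%:R)%E); last first.
  by apply: lte_add_pinfty; [rewrite eGamma1; exact: ltry|exact: gn].
have mE (c : R) : measurable_fun (Rpos : set R) (EFin \o (fun t => t `^ c * expR (- t))).
  exact: emeasurable_Gamma_integrand.
have ge0 (c : R) (t : R) : Rpos t -> (0 <= (t `^ c * expR (- t))%:E)%E.
  by rewrite lee_fin mulr_ge0 ?powR_ge0 ?expR_ge0.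
rewrite /eGamma -ge0_integralD//; [|exact: ge0|exact: mE|exact: ge0|exact: mE].
apply: ge0_le_integral => //; [exact: ge0|exact: mE| |].
  by apply: emeasurable_funD; exact: mE.
move=> t /=; rewrite in_itv/= andbT => t0.
rewrite -EFinD lee_fin -mulrDl ler_wpM2r ?expR_ge0// subrr powRr0.
rewrite -natr1 addrK; have [t1|/ltW t1] := leP t 1.
  have h : t `^ (b - 1) <= t `^ 0 by rewrite ger_powR ?t0 ?subr_ge0.
  by rewrite powRr0 in h; rewrite (le_trans h)// lerDl powR_ge0.
by apply: (le_trans (ler_powR t1 bm)); rewrite lerDr.
Qed.

Lemma Gamma_gt0 a : 0 < a -> 0 < Gamma a.
Proof.
move=> a0; rewrite GammaE fine_gt0// eGamma_lty// andbT.
(* On [[1, 2]], [0 < a] gives [t^(a-1) >= 1/t >= 1/2], while [exp(-t) >= exp(-2)]. *)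
have c0 : 0 < expR (- 2) / 2 :> R by rewrite mulr_gt0 ?expR_gt0.
apply: (@lt_le_trans _ _
    (\int[mu]_(t in `[1%R, 2%R]) (expR (- 2) / 2)%:E)%E).
  rewrite integral_cst//= lebesgue_measure_itv/= lte_fin ltr1n mule_gt0//.
  by rewrite lte_fin// subr_gt0 ltr1n.
apply: (@le_trans _ _
    (\int[mu]_(t in `[1%R, 2%R]) (t `^ (a - 1) * expR (- t))%:E)%E).
  apply: ge0_le_integral => //.
  - exact: emeasurable_Gamma_integrand.
  - move=> t /=; rewrite in_itv/= => /andP[t1 t2].
    rewrite lee_fin mulrC ler_pM ?expR_ge0 ?invr_ge0//; last first.
      by rewrite ler_expR lerN2.
    apply: (@le_trans _ _ (t `^ (-1))).
      by rewrite powR_inv1 ?lef_pV2 ?posrE ?(lt_le_trans _ t1) ?(le_trans _ t1).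
    by rewrite ler_powR// lerBrDr addNr ltW.
apply: ge0_subset_integral => //.
- exact: emeasurable_Gamma_integrand.
- by move=> t _; rewrite lee_fin mulr_ge0 ?powR_ge0 ?expR_ge0.
- by move=> t /=; rewrite !in_itv/= andbT => /andP[+ _]; exact: lt_le_trans.
Qed.

Lemma GammaS a : 0 < a -> Gamma (a + 1) = a * Gamma a.
Proof.
by move=> a0; rewrite GammaE eGammaS// fineM// ge0_fin_numE ?eGamma_lty ?eGamma_ge0.
Qed.

End GammaFunction.

(** * Power series dominated by the exponential series *)

Section ExponentialSeries.
Context {R : realType}.
Implicit Types (c : nat -> R) (x : R).

(* Stable under [pseries_diffs], so that such a power series may be
   differentiated any number of times, on the whole line. *)
Definition exp_dominated c := forall k, `|c k| <= (k`!%:R)^-1.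

Lemma exp_dominated_diffs c : exp_dominated c -> exp_dominated (pseries_diffs c).
Proof.
move=> hc k; rewrite /pseries_diffs normrM ger0_norm// -ler_pdivlMl//.
by rewrite -invfM -natrM -factS.
Qed.

Lemma exp_dominated_cvg c x : exp_dominated c -> cvgn (pseries c x).
Proof.
move=> hc; apply: normed_cvg.
apply: series_le_cvg (is_cvg_series_exp_coeff `|x|) => k.
- exact: normr_ge0.
- by rewrite /exp_coeff/= mulr_ge0 ?exprn_ge0 ?invr_ge0.
- by rewrite /exp_coeff/= normrM normrX mulrC ler_wpM2l ?exprn_ge0.
Qed.

Lemma exp_dominated_is_derive c x : exp_dominated c ->
  is_derive x 1 (fun y => limn (pseries c y)) (limn (pseries (pseries_diffs c) x)).
Proof.
move=> hc; have hc1 := exp_dominated_diffs _ hc.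
(* Termwise differentiation at [x] asks for convergence at a point of larger modulus; [|x| + 1] is
   one. *)
apply: (@pseries_snd_diffs _ c (`|x| + 1)); try exact: exp_dominated_cvg.
  by apply: exp_dominated_cvg; exact: exp_dominated_diffs.
by rewrite [ltRHS]ger0_norm ?addr_ge0// ltrDl.
Qed.

End ExponentialSeries.

(** * The normalized Bessel function as an entire function of [z^2] *)

Section BesselSeries.
Context {R : realType}.
Variable alpha : R.
Hypothesis halpha : - (1 / 2) <= alpha.

(** Coefficient of [z^(2k)] in [j_alpha z]. *)
Definition bessel_coef (k : nat) : R :=
  (-1) ^+ k / (4 ^+ k * k`!%:R) * (Gamma (alpha + 1) / Gamma (k%:R + alpha + 1)).

Let Gk_gt0 (k : nat) : 0 < Gamma (k%:R + alpha + 1) :> R.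
Proof.
apply: Gamma_gt0; have := ler0n R k; move: halpha; lra.
Qed.

Lemma bessel_coef0 : bessel_coef 0 = 1.
Proof.
have := Gk_gt0 0; rewrite /bessel_coef !expr0 fact0 !mul1r invr1 mul1r add0r.
by move=> G0; rewrite divff ?gt_eqF.
Qed.

Lemma bessel_coefS k :
  4 * (k.+1%:R * (k%:R + alpha + 1)) * bessel_coef k.+1 = - bessel_coef k.
Proof.
rewrite /bessel_coef.
have k0 : 0 <= k%:R :> R by [].
have p0 : 0 < k%:R + alpha + 1 by move: halpha; lra.
have -> : k.+1%:R + alpha + 1 = (k%:R + alpha + 1) + 1 :> R.
  by rewrite -natr1; ring.
rewrite (GammaS _ p0) !exprS factS natrM -natr1.
have G0 := Gk_gt0 k.
field.
rewrite !gt_eqF ?exprn_gt0 ?ltr0n ?fact_gt0//=; lra.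
Qed.

(** As [alpha >= -1/2], the factor [4 (k + alpha + 1)] of the recurrence is at least 2, so
    [(k+1) |c_(k+1)| <= |c_k|]. *)
Lemma bessel_coef_exp_dominated : exp_dominated bessel_coef.
Proof.
elim=> [|k IH]; first by rewrite bessel_coef0 normr1 fact0 invr1.
have k0 : 0 <= k%:R :> R by [].
have h : k.+1%:R * `|bessel_coef k.+1| <= `|bessel_coef k|.
  rewrite -[leRHS]normrN -bessel_coefS [leRHS]normrM ler_wpM2r ?normr_ge0//.
  move: halpha => ha; rewrite ger0_norm -?natr1; nra.
rewrite factS natrM invfM ler_pdivlMl//.
exact: le_trans h IH.
Qed.

(** In the variable [s = z^2] no real power and no singularity at 0 remains; the next two series are
    its first two derivatives. *)
Definition bessel_ent (s : R) := limn (pseries bessel_coef s).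
Definition bessel_ent1 (s : R) := limn (pseries (pseries_diffs bessel_coef) s).
Definition bessel_ent2 (s : R) :=
  limn (pseries (pseries_diffs (pseries_diffs bessel_coef)) s).

Lemma bessel_ent_is_derive (s : R) : is_derive s (1 : R) bessel_ent (bessel_ent1 s).
Proof. exact: exp_dominated_is_derive bessel_coef_exp_dominated. Qed.

Lemma bessel_ent1_is_derive (s : R) : is_derive s (1 : R) bessel_ent1 (bessel_ent2 s).
Proof.
by apply/exp_dominated_is_derive/exp_dominated_diffs/bessel_coef_exp_dominated.
Qed.

(** Bessel's equation rewritten in [s = z^2]: the coefficient of each [s^i] vanishes by
    [bessel_coefS]. *)
Lemma bessel_ent_ode (s : R) :
  4 * s * bessel_ent2 s + 4 * (alpha + 1) * bessel_ent1 s + bessel_ent s = 0.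
Proof.
pose c := bessel_coef; pose d := pseries_diffs c.
have cc : pseries c s @ \oo --> bessel_ent s.
  exact: exp_dominated_cvg bessel_coef_exp_dominated.
have cd : pseries d s @ \oo --> bessel_ent1 s.
  exact/exp_dominated_cvg/exp_dominated_diffs/bessel_coef_exp_dominated.
(* In this indexing, multiplication by [s] aligns the series with the other two, so that every
   partial sum of the combination is exactly 0. *)
have ce : series (fun i => i%:R * d i * s ^+ i.-1) @ \oo --> bessel_ent2 s.
  apply: pseries_diffs_equiv; apply: exp_dominated_cvg.
  by do 2 apply: exp_dominated_diffs; exact: bessel_coef_exp_dominated.
have : 4 * s * series (fun i => i%:R * d i * s ^+ i.-1) n
    + 4 * (alpha + 1) * pseries d s n + pseries c s n @[n --> \oo] -->
    4 * s * bessel_ent2 s + 4 * (alpha + 1) * bessel_ent1 s + bessel_ent s.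
  apply: cvgD => //; apply: cvgD; apply: cvgM => //; exact: cvg_cst.
under eq_fun => n.
  rewrite /pseries /series /= !mulr_sumr -!big_split/= big1; last first.
    move=> i _; rewrite /d /pseries_diffs.
    have h := bessel_coefS i; rewrite -/c in h.
    have -> : c i = - (4 * (i.+1%:R * (i%:R + alpha + 1)) * c i.+1).
      by rewrite h opprK.
    case: i {h} => [|i]; rewrite ?expr0 ?exprS/=; ring.
  over.
by move=> /(cvg_unique _ (cvg_cst 0)) ->.
Qed.

Lemma bessel_jE (z : R) : 0 <= z -> bessel_j alpha z = bessel_ent (z ^+ 2).
Proof.
rewrite le_eqVlt => /predU1P[<-|z0].
  rewrite /bessel_j eqxx expr0n/=; apply/esym/cvg_lim => //.
  (* At 0 every nonempty partial sum equals the constant coefficient; the shift discards the empty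
     one. *)
  rewrite -(cvg_shiftS _); apply: cvg_near_cst; apply: nearW => n.
  rewrite /pseries/= seriesEnat/= big_nat_recl//= big1 ?addr0.
    by rewrite expr0 mulr1 bessel_coef0.
  by move=> i _; rewrite expr0n/= mulr0.
rewrite /bessel_j gt_eqF//.
have z20 : 0 < z / 2 by rewrite divr_gt0.
set B := Gamma (alpha + 1) * (z / 2) `^ (- alpha).
have B0 : 0 < B.
  rewrite mulr_gt0 ?powR_gt0//; by have := Gk_gt0 0; rewrite add0r.
suff -> : besselJ alpha z = B^-1 * bessel_ent (z ^+ 2).
  by rewrite mulrA divff ?gt_eqF// mul1r.
apply/cvg_lim => //.
rewrite (_ : [series _]_k = (fun n => B^-1 * pseries bessel_coef (z ^+ 2) n)).
  apply: cvgM; first exact: cvg_cst.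
  exact: exp_dominated_cvg bessel_coef_exp_dominated.
(* The series agree term by term, since [(z/2)^(2k + alpha) = z^(2k) 4^(-k) (z/2)^alpha]. *)
apply/funext => n; rewrite /pseries /series/= mulr_sumr; apply: eq_bigr => k _.
rewrite /bessel_coef /B powRN.
rewrite powRD; last by apply/implyP => _; rewrite gt_eqF.
rewrite -natrM powR_mulrn ?ltW// exprM expr_div_n -exprM.
have h4 : (2 : R) ^+ 2 = 4 by rewrite -natrX.
rewrite exprM expr_div_n h4.
have := Gk_gt0 0; rewrite add0r => G0.
have G1 := Gk_gt0 k.
have P0 : 0 < (z / 2) `^ alpha by rewrite powR_gt0.
field.
by rewrite !gt_eqF ?exprn_gt0 ?ltr0n ?fact_gt0.
Qed.

End BesselSeries.

(** * Boundedness and decay of the normalized Bessel function *)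

Section BesselBound.
Context {R : realType}.

(* With [u = z^p j] and [v = z^(-p) u'], the energy of [u] is
   [z^(2p) (v^2 + j^2)], and multiplying it by [exp (|p^2 - p| / z)] makes it
   nonincreasing. *)
Lemma oscillator_bound (p : R) (j j1 : R -> R) :
  (forall z : R, 0 < z -> is_derive z (1 : R) j (j1 z)) ->
  (forall z : R, 0 < z -> is_derive z (1 : R) j1 (- (2 * p / z) * j1 z - j z)) ->
  exists C : R, forall z : R, 1 <= z -> `|j z| <= C * z `^ (- p).
Proof.
move=> dj dj1.
pose K : R := `|p ^+ 2 - p|.
pose v (z : R) := j1 z + p * z^-1 * j z.
pose Q (z : R) := v z ^+ 2 + j z ^+ 2.
pose h (z : R) := 2 * p * ln z + K * z^-1.
pose F (z : R) := expR (h z) * Q z.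
(* Here [Q' = -(2p/z) Q + 2 (p^2 - p) v j / z^2]. The factor [z^(2p)] inside [expR (h z)] cancels
   the first term and [exp(K/z)] contributes [- K Q / z^2]. *)
have dF (z : R) : 0 < z -> is_derive z (1 : R) F
    (expR (h z) * (2 * (p ^+ 2 - p) * (v z * j z) - K * Q z) / z ^+ 2).
  move=> z0.
  have z_neq0 : z != 0 by rewrite gt_eqF.
  have djz := dj _ z0; have dj1z := dj1 _ z0.
  have dlnz := is_derive1_ln z0.
  have dVz : is_derive z (1 : R) (fun y : R => y^-1) (- z ^- 2).
    have := @is_deriveV _ id z 1 1 z_neq0 (is_derive_id _ _).
    by rewrite /GRing.scale/= mulr1.
  have dv : is_derive z (1 : R) v
      (- j z - p * z^-1 * v z + (p ^+ 2 - p) * z ^- 2 * j z).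
    apply: (is_derive_eq (is_deriveD dj1z
      (is_deriveM (is_deriveM (is_derive_cst p z 1) dVz) djz))).
    by rewrite /v /GRing.scale/= !fctE; field.
  have dQ := is_deriveD (is_deriveX 2 dv) (is_deriveX 2 djz).
  have dh := is_deriveD (is_deriveM (is_derive_cst (2 * p) z 1) dlnz)
    (is_deriveM (is_derive_cst K z 1) dVz).
  have dE := is_derive1_comp (is_derive_expR (h z)) dh.
  apply: (is_derive_eq (is_deriveM dE dQ)).
  rewrite /GRing.scale/= !fctE -/(h z) /Q.
  have -> : j1 z = v z - p * z^-1 * j z by rewrite /v addrK.
  by field.
have F'le0 (z : R) : 0 < z ->
    expR (h z) * (2 * (p ^+ 2 - p) * (v z * j z) - K * Q z) / z ^+ 2 <= 0.
  move=> z0; rewrite pmulr_lle0 ?invr_gt0 ?exprn_gt0// pmulr_rle0 ?expR_gt0//.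
  (* What remains is [2 m a b <= |m| (a^2 + b^2)], which follows from the squares of [a + b] and
     [a - b]. *)
  rewrite subr_le0 /Q.
  have := ler_norm (p ^+ 2 - p); have := lerNnormlW (lexx `|p ^+ 2 - p|).
  rewrite -/K; move: (v z) (j z) => a b; set m := p ^+ 2 - p => h1 h2.
  have := sqr_ge0 (a + b); have := sqr_ge0 (a - b); nra.
have Fdecr (z : R) : 1 <= z -> F z <= F 1.
  move=> z1; apply: (@ler0_derive1_nincry R F 1);
    [move=> y|move=> y| |exact: lexx|exact: z1].
  - rewrite in_itv/= andbT => y1; have [] := dF _ (lt_trans ltr01 y1) => //.
  - rewrite in_itv/= andbT => y1; have y0 := lt_trans ltr01 y1.
    by rewrite derive1E; have [_ ->] := dF _ y0; exact: F'le0.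
  - apply: continuous_in_subspaceT => y; rewrite inE/= in_itv/= andbT => y1.
    apply: differentiable_continuous; apply/derivable1_diffP.
    by have [] := dF _ (lt_le_trans ltr01 y1).
(* Dropping [v^2 >= 0] and [exp(K/z) >= 1] leaves [z^(2p) j^2 <= F z <= F 1]. *)
exists (Num.sqrt (F 1)) => z z1.
have z0 := lt_le_trans ltr01 z1.
rewrite powRN ler_pdivlMr ?powR_gt0// -[leLHS]ger0_norm ?mulr_ge0 ?powR_ge0//.
rewrite -sqrtr_sqr ler_wsqrtr// (le_trans _ (Fdecr z z1))//.
rewrite /F /h /powR gt_eqF// expRD exprMn real_normK ?num_real// -expRM_natl.
rewrite mulrC -mulrA -[X in X * _](_ : expR (2 * p * ln z) = _); last first.
  by congr expR; ring.
rewrite ler_pM2l ?expR_gt0// /Q -[X in X <= _]mul1r ler_pM ?sqr_ge0//.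
  by rewrite -[leLHS]expR0 ler_expR divr_ge0 ?normr_ge0// ltW.
by rewrite lerDr sqr_ge0.
Qed.

(** The energy estimate covers [z >= 1] and continuity covers [[0, 1]]. As [alpha + 1/2 >= 0], the
    power is at least 1 on []0, 1]] and at most 1 beyond, so one constant serves both bounds. *)
Lemma bessel_j_bound (alpha : R) : - (1 / 2) <= alpha ->
  exists2 C : R, 0 < C & forall z, 0 <= z -> `|bessel_j alpha z| <= C /\
    (0 < z -> `|bessel_j alpha z| <= C * z `^ (- (alpha + 1 / 2))).
Proof.
move=> ha; pose p := alpha + 1 / 2.
have p0 : 0 <= p by rewrite /p; move: ha; lra.
pose j z := bessel_ent alpha (z ^+ 2).
pose j1 z := 2 * z * bessel_ent1 alpha (z ^+ 2).
have dsq (z : R) : is_derive z (1 : R) (fun y : R => y ^+ 2) (2 * z).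
  apply: is_derive_eq (is_deriveX 2 (is_derive_id z (1 : R))) _.
  by rewrite /GRing.scale/= mulr1.
have dj (z : R) : is_derive z (1 : R) j (j1 z).
  apply: is_derive_eq (is_derive1_comp (bessel_ent_is_derive _ ha _) (dsq z)) _.
  by rewrite mulrC.
(* Bessel's equation [j'' + ((2 alpha + 1)/z) j' + j = 0], with [2p = 2 alpha + 1]. *)
have dj1 (z : R) : 0 < z -> is_derive z (1 : R) j1 (- (2 * p / z) * j1 z - j z).
  move=> z0; apply: is_derive_eq (is_deriveM
    (is_deriveM (is_derive_cst (2 : R) z (1 : R)) (is_derive_id z (1 : R)))
    (is_derive1_comp (bessel_ent1_is_derive _ ha _) (dsq z))) _.
  rewrite /GRing.scale/= !fctE.
  have -> : j z = - (4 * z ^+ 2 * bessel_ent2 alpha (z ^+ 2)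
      + 4 * (alpha + 1) * bessel_ent1 alpha (z ^+ 2)).
    by apply/eqP; rewrite -addr_eq0 addrC bessel_ent_ode.
  by rewrite /j1 /p; field; rewrite gt_eqF.
have [C1 hC1] := @oscillator_bound p j j1 (fun z _ => dj z) dj1.
have [C2 hC2] : exists C : R, forall z, z \in `[0, 1] -> `|j z| <= C.
  have cj : {within `[0, 1], continuous (fun z => `|j z|)}.
    apply: continuous_subspaceT => z; apply: continuous_comp; last exact: norm_continuous.
    apply: differentiable_continuous; apply/derivable1_diffP.
    by have [] := dj z.
  have [c _ hc] := EVT_max ler01 cj.
  by exists `|j c|.
pose C := Num.max 1 (Num.max C1 C2).
have C0 : 0 < C by rewrite /C lt_max ltr01.
have C1C : C1 <= C by rewrite /C !le_max lexx !orbT.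
have C2C : C2 <= C by rewrite /C !le_max lexx !orbT.
exists C => // z z0; rewrite bessel_jE// -/(j z).
have [z1|/ltW z1] := leP z 1.
  have jC : `|j z| <= C by apply: le_trans C2C; apply: hC2; rewrite in_itv/= z0.
  split=> // zp; apply: (le_trans jC); rewrite ler_pMr// -[leLHS](powRr0 z).
  by rewrite ger_powR ?zp// oppr_le0.
have jC : `|j z| <= C * z `^ (- p).
  by rewrite (le_trans (hC1 _ z1))// ler_wpM2r ?powR_ge0.
split=> //; apply: (le_trans jC); rewrite ler_piMr ?(ltW C0)// -[leRHS](powRr0 z).
by rewrite ler_powR// oppr_le0.
Qed.

Lemma measurable_bessel_j (alpha r : R) (D : set R) : - (1 / 2) <= alpha ->
  0 <= r -> (forall t, D t -> 0 <= t) -> measurable D ->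
  measurable_fun D (fun t => bessel_j alpha (r * t)).
Proof.
move=> ha r0 D0 mD.
apply: (@eq_measurable_fun _ _ _ _ D (fun t => bessel_ent alpha ((r * t) ^+ 2))).
  by move=> t; rewrite inE => /D0 t0; rewrite bessel_jE// mulr_ge0.
apply: measurable_funTS; apply: continuous_measurable_fun => t.
have crt : {for t, continuous (fun t : R => (r * t) ^+ 2)}.
  have c1 : {for t, continuous (fun t : R => r * t)}.
    by apply: (@continuousM R R (cst r) id); [exact: cvg_cst|exact: cvg_id].
  exact: (@continuousM R R (fun t => r * t) (fun t => r * t)).
apply: (continuous_comp crt).
apply: differentiable_continuous; apply/derivable1_diffP.
by have [] := bessel_ent_is_derive _ ha ((r * t) ^+ 2).
Qed.

End BesselBound.

(** * Integrability and integrals of complex-valued functions *)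

Section ComplexIntegrable.
Context {R : realType}.
Implicit Types (D A B : set R) (g : R -> R[i]).
Local Notation mu := (@lebesgue_measure R).

Lemma ge_Re_normc (x : R[i]) : `|complex.Re x| <= normc x.
Proof. by case: x => a b /=; rewrite -sqrtr_sqr ler_wsqrtr// lerDl sqr_ge0. Qed.

Lemma ge_Im_normc (x : R[i]) : `|complex.Im x| <= normc x.
Proof. by case: x => a b /=; rewrite -sqrtr_sqr ler_wsqrtr// lerDr sqr_ge0. Qed.

Lemma normc_ge0 (x : R[i]) : 0 <= normc x.
Proof. by case: x => a b; exact: sqrtr_ge0. Qed.

Lemma normc_le (x : R[i]) : normc x <= `|complex.Re x| + `|complex.Im x|.
Proof.
case: x => a b /=; rewrite -[leRHS]ger0_norm ?addr_ge0// -sqrtr_sqr.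
rewrite ler_wsqrtr// sqrrD !real_normK ?num_real//.
by rewrite -addrA lerD2l lerDr mulrn_wge0 ?mulr_ge0.
Qed.

Lemma ReZ (a : R) (x : R[i]) : complex.Re (a%:C * x) = a * complex.Re x.
Proof. by case: x => b c /=; rewrite mul0r subr0. Qed.

Lemma ImZ (a : R) (x : R[i]) : complex.Im (a%:C * x) = a * complex.Im x.
Proof. by case: x => b c /=; rewrite mul0r addr0. Qed.

Lemma normcZ (a : R) (x : R[i]) : normc (a%:C * x) = `|a| * normc x.
Proof.
by rewrite ComplexField.Normc.normcM /= expr0n/= addr0 sqrtr_sqr.
Qed.

Lemma measurable_normc D g : measurable_fun D (fun t => complex.Re (g t)) ->
  measurable_fun D (fun t => complex.Im (g t)) ->
  measurable_fun D (fun t => normc (g t)).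
Proof.
move=> mR mI.
have -> : (fun t => normc (g t)) =
    Num.sqrt \o (fun t => complex.Re (g t) ^+ 2 + complex.Im (g t) ^+ 2).
  by apply/funext => t /=; case: (g t).
apply: measurableT_comp.
  by apply: continuous_measurable_fun; exact: sqrt_continuous.
by apply: measurable_funD; exact: measurable_funX.
Qed.

Lemma L1_integrable_normc D g : measurable D -> L1 D g ->
  mu.-integrable D (EFin \o (fun t => normc (g t))).
Proof.
move=> mD [mR mI fin]; apply/integrableP; split.
  by apply/measurable_EFinP; exact: measurable_normc.
apply: le_lt_trans fin; rewrite le_eqVlt; apply/orP; left; apply/eqP.
by apply: eq_integral => t _ /=; rewrite ger0_norm ?normc_ge0.
Qed.

Lemma L1_integrable_Re D g : measurable D -> L1 D g ->
  mu.-integrable D (EFin \o (fun t => complex.Re (g t))).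
Proof.
move=> mD h; apply: le_integrable (L1_integrable_normc D g mD h) => //.
  by apply/measurable_EFinP; case: h.
move=> t _ /=; rewrite lee_fin [leRHS]ger0_norm ?normc_ge0//.
exact: ge_Re_normc.
Qed.

Lemma L1_integrable_Im D g : measurable D -> L1 D g ->
  mu.-integrable D (EFin \o (fun t => complex.Im (g t))).
Proof.
move=> mD h; apply: le_integrable (L1_integrable_normc D g mD h) => //.
  by apply/measurable_EFinP; case: h.
move=> t _ /=; rewrite lee_fin [leRHS]ger0_norm ?normc_ge0//.
exact: ge_Im_normc.
Qed.

Lemma L1Z_bounded D (a : R -> R) g (M : R) : measurable D ->
  measurable_fun D a -> (forall t, D t -> `|a t| <= M) -> L1 D g ->
  L1 D (fun t => (a t)%:C * g t).
Proof.
move=> mD ma aM h; have := L1_integrable_normc D g mD h.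
case: h => mR mI _ ig; split.
- rewrite (_ : (fun _ => _) = a \* (fun t => complex.Re (g t))).
    exact: measurable_funM.
  by apply/funext => t; rewrite ReZ.
- rewrite (_ : (fun _ => _) = a \* (fun t => complex.Im (g t))).
    exact: measurable_funM.
  by apply/funext => t; rewrite ImZ.
pose b (t : R) : R := `|a t|.
have : mu.-integrable D ((EFin \o b) \* (EFin \o (fun t => normc (g t))))%E.
  apply: integrableMr => //.
    by apply: measurableT_comp.
  exists `|M|; split; first exact: num_real.
  move=> x Mx t Dt /=; rewrite normr_id (le_trans (aM t Dt))//.
  by rewrite (le_trans (ler_norm _))// ltW.
move=> /integrableP[_]; apply: le_lt_trans.
rewrite le_eqVlt; apply/orP; left; apply/eqP.
apply: eq_integral => t _ /=.
by rewrite normcZ [in RHS]ger0_norm// mulr_ge0 ?normc_ge0// normr_ge0.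
Qed.

Lemma eq_L1 D g g' : (forall t, D t -> g t = g' t) -> L1 D g -> L1 D g'.
Proof.
move=> gg' [mR mI fin]; split.
- by apply: eq_measurable_fun mR => t; rewrite inE => /gg' ->.
- by apply: eq_measurable_fun mI => t; rewrite inE => /gg' ->.
- by move: fin; under eq_integral => t do [rewrite inE => /gg' ->].
Qed.

Lemma sub_L1 A B g : measurable A -> measurable B -> A `<=` B ->
  L1 B g -> L1 A g.
Proof.
move=> mA mB AB h; have := L1_integrable_normc B g mB h.
case: h => mR mI fin /integrableP[mn _]; split.
- exact: measurable_funS mR.
- exact: measurable_funS mI.
apply: le_lt_trans fin; apply: ge0_subset_integral => //.
by move=> t _; rewrite lee_fin normc_ge0.
Qed.

Lemma L1_setU A B g : measurable A -> measurable B ->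
  L1 A g -> L1 B g -> L1 (A `|` B) g.
Proof.
move=> mA mB hA hB.
have mBA : measurable (B `\` A) by exact: measurableD.
have hBA : L1 (B `\` A) g by apply: (sub_L1 _ B) hB => //; exact: subDsetl.
have -> : A `|` B = A `|` (B `\` A) by rewrite setDE setUIr setUv setIT.
case: hA => mRA mIA fA; case: hBA => mRB mIB fB.
have mR : measurable_fun (A `|` (B `\` A)) (fun t => complex.Re (g t)).
  by apply/measurable_funU.
have mI : measurable_fun (A `|` (B `\` A)) (fun t => complex.Im (g t)).
  by apply/measurable_funU.
split => //; rewrite ge0_integral_setU//.
- exact: lte_add_pinfty.
- by apply/measurable_EFinP; exact: measurable_normc.
- by move=> t _; rewrite lee_fin normc_ge0.
- by apply/disj_setPS => t [At [_ /(_ At)]].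
Qed.

Lemma L1_set1 (a : R) g : L1 [set a] g.
Proof.
by split; rewrite ?integral_set1 ?ltry//; exact: measurable_fun_set1.
Qed.

(** Monotone convergence on []1, n+1]] handles integer cut-offs; nonnegativity makes the tail
    decrease in [N], which reaches real ones. *)
Lemma tail_integral_cvg0 (g : R -> R) : (forall t, 0 <= g t) ->
  mu.-integrable `]1, +oo[ (EFin \o g) ->
  \int[mu]_(t in `[N, +oo[) g t @[N --> +oo] --> (0 : R).
Proof.
move=> g0 ig.
pose F n : set R := [set` `]1, n.+1%:R]].
have UF : \bigcup_n F n = [set` `]1%R, +oo[%R].
  apply/seteqP; split => [t [n _]|t]; rewrite /F/= !in_itv/= andbT.
    by case/andP.
  move=> t1; exists (Num.truncn t) => //=.
  by rewrite in_itv/= t1/= ltW// truncnS_gt.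
have ndF : nondecreasing_seq F.
  move=> m n mn; rewrite subsetEset /F; apply: subset_itv; rewrite bnd_simp//.
  by rewrite ler_nat ltnS.
have iF n : mu.-integrable (F n) (EFin \o g).
  apply: integrableS ig => //; first exact: measurable_itv.
  by move=> t; rewrite /F/= !in_itv/= andbT => /andP[].
have cvgF : \int[mu]_(t in F n) g t @[n --> \oo] --> \int[mu]_(t in `]1, +oo[) g t.
  apply: fine_cvg.
  rewrite fineK; last exact: integrable_fin_num.
  rewrite -UF; apply: ge0_nondecreasing_set_cvg_integral => //.
  - by move=> n; exact: measurable_itv.
  - by move=> n; exact: measurable_int (iF n).
  - by move=> n t _; rewrite lee_fin.
apply/cvgrPdist_le => e e0.
move/cvgrPdist_le : cvgF => /(_ e e0) [n0 _ /(_ n0 (leqnn _))].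
move=> hn; near=> N.
(* One more than the endpoint [n0 + 1], so that the closed ray from [N] lies in the open ray from
   [n0 + 1]. *)
have Nn : n0.+2%:R <= N by [].
rewrite sub0r normrN ger0_norm; last exact: Rintegral_ge0.
apply: le_trans hn.
rewrite Rintegral_itvB//; last by rewrite bnd_simp ler1n.
apply: le_trans (ler_norm _).
rewrite /Rintegral fine_le//.
- apply: integrable_fin_num => //; apply: integrableS ig => //.
  move=> t /=; rewrite !in_itv/= !andbT; apply: lt_le_trans.
  by rewrite (lt_le_trans _ Nn)// ltr1n.
- apply: integrable_fin_num => //; apply: integrableS ig => //.
  move=> t /=; rewrite !in_itv/= !andbT; apply: le_lt_trans.
  by rewrite ler1n.
apply: ge0_subset_integral => //.
- apply: measurable_int; apply: integrableS ig => //.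
  move=> t /=; rewrite !in_itv/= !andbT; apply: le_lt_trans.
  by rewrite ler1n.
- by move=> t _; rewrite lee_fin.
- move=> t /=; rewrite !in_itv/= !andbT; apply: lt_le_trans.
  by rewrite (lt_le_trans _ Nn)// ltr_nat.
Unshelve. all: end_near. Qed.

(** The factor 2 arises from bounding the real and imaginary parts separately by the modulus. *)
Lemma normc_cintegral_le D g : measurable D -> L1 D g ->
  normc (cintegral D g) <= 2 * \int[mu]_(t in D) normc (g t).
Proof.
move=> mD h; apply: le_trans (normc_le _) _.
have iN := L1_integrable_normc D g mD h.
have iR := L1_integrable_Re D g mD h.
have iI := L1_integrable_Im D g mD h.
rewrite mulr_natl mulr2n; apply: lerD => /=.
  apply: (le_trans (le_normr_Rintegral _ iR)) => //.
  apply: le_Rintegral => //; first exact: integrable_norm.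
  by move=> t _; exact: ge_Re_normc.
apply: (le_trans (le_normr_Rintegral _ iI)) => //.
apply: le_Rintegral => //; first exact: integrable_norm.
by move=> t _; exact: ge_Im_normc.
Qed.

Lemma cintegral_setU A B g : measurable A -> measurable B -> [disjoint A & B] ->
  L1 (A `|` B) g -> cintegral (A `|` B) g = cintegral A g + cintegral B g.
Proof.
move=> mA mB AB h; have mU := measurableU _ _ mA mB.
rewrite /cintegral !Rintegral_setU//; first exact: L1_integrable_Im.
exact: L1_integrable_Re.
Qed.

End ComplexIntegrable.

(** * From a common error bound to uniform convergence *)

Section UniformLimit.
Context {R : realType}.

Lemma complex_normE (z : R[i]) : `|z| = (normc z)%:C.
Proof. by case: z. Qed.

(** The limit [L] depends on [r] but the error bound [T] does not, and uniqueness of limits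
    identifies [L] with [lim]. *)
Lemma uniform_cvg_lim (P : R -> R -> R[i]^o) (E : set R) (T : R -> R) :
  T N @[N --> +oo] --> (0 : R) ->
  (forall r, E r -> exists L, forall N, 1 < N -> normc (L - P N r) <= T N) ->
  (forall r, E r -> cvg (P N r @[N --> +oo])) /\
  {uniform E, P N @[N --> +oo] --> (fun r => lim (P N r @[N --> +oo]) : R[i]^o)}.
Proof.
move=> T0 hE.
have near_lt (e : R[i]) : 0 < e ->
    \forall N \near +oo, 1 < N /\ forall z : R[i], normc z <= T N -> `|z| < e.
  (* In the partial order of [R[i]], a positive [e] has zero imaginary part and so is a positive
     real. *)
  case: e => e e'; rewrite ltcE/= => /andP[/eqP -> e0].
  have := T0; move/cvgrPdist_lt => /(_ e e0) hT; near=> N; split=> // z zN.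
  rewrite complex_normE ltcR (le_lt_trans zN)//.
  have : `|0 - T N| < e by near: N.
  by rewrite sub0r normrN; apply: le_lt_trans; exact: ler_norm.
have cvgL r (L : R[i]^o) : (forall N, 1 < N -> normc (L - P N r) <= T N) ->
    P N r @[N --> +oo] --> L.
  move=> hL; apply/cvgrPdist_lt => e /near_lt; apply: filterS => N [N1].
  by apply; exact: hL.
split=> [r /hE[L /cvgL]|]; first exact: cvgP.
move=> U /uniform_nbhs[V [entV VU]].
have [e /= e0 eV] : filter_from [set x | 0 < x]
    (fun e : R[i] => [set xy : R[i]^o * R[i]^o | ball xy.1 e xy.2]) V.
  by rewrite entourage_from_ballE.
apply: filterS (near_lt e e0) => N [N1 hN]; apply: VU => r /hE[L hL].
apply: eV => /=; rewrite -ball_normE/=.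
have -> : lim (P N r @[N --> +oo]) = L.
  by apply: cvg_lim; [exact: norm_hausdorff|exact: cvgL].
by apply: hN; exact: hL.
Unshelve. all: end_near. Qed.

End UniformLimit.

(** * Tail estimate for the transform and its uniform convergence *)

Section HankelTransform.
Context {R : realType}.
Variables (alpha nu mu : R) (f : R -> R[i]).
Hypothesis halpha : - (1 / 2) <= alpha.
Hypothesis h0 : L1 `]0, 1[ (fun t => (t `^ nu)%:C * f t).
Hypothesis hoo : L1 `]1, +oo[ (fun t => (t `^ (nu - alpha - 1 / 2))%:C * f t).

Let p : R := alpha + 1 / 2.

Let p_ge0 : 0 <= p.
Proof. by rewrite /p; move: halpha; lra. Qed.

(** Isolates the weight of [hoo]; the decay of [j_alpha] bounds the other factor in [t] when
    [0 < r]. *)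
Let weighted_integrand t r : 0 < t ->
  integrand alpha nu f r t =
  (t `^ p * bessel_j alpha (r * t))%:C * ((t `^ (nu - alpha - 1 / 2))%:C * f t).
Proof.
move=> t0; rewrite /integrand mulrA; congr (_ * _); rewrite -rmorphM/=.
congr (_ %:C); rewrite mulrAC -powRD; last by apply/implyP => _; rewrite gt_eqF.
by congr (_ `^ _ * _); rewrite /p; ring.
Qed.

(** Near 0 boundedness of [j_alpha] suffices with [h0]; beyond 1, [M] is paired with [hoo]. The
    bound [b] may be finite or infinite. *)
Lemma integrand_L1 (b : itv_bound R) (M r : R) : 0 <= r ->
  (forall t, t \in Interval (BRight 1) b -> `|t `^ p * bessel_j alpha (r * t)| <= M) ->
  L1 [set` Interval (BRight 0) b] (integrand alpha nu f r).
Proof.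
move=> r0 hM.
have [C _ hC] := bessel_j_bound alpha halpha.
have L01 : L1 `]0, 1[ (integrand alpha nu f r).
  apply: (eq_L1 _ (fun t => (bessel_j alpha (r * t))%:C * ((t `^ nu)%:C * f t))).
    by move=> t _; rewrite /integrand mulrA -rmorphM/= (mulrC (bessel_j _ _)).
  apply: (L1Z_bounded _ _ _ C) => //.
    by apply: measurable_bessel_j => // t; rewrite /= in_itv/= => /andP[/ltW].
  move=> t; rewrite /= in_itv/= => /andP[/ltW t0 _].
  by have [] := hC (r * t) (mulr_ge0 r0 t0).
have sub1 : [set` Interval (BRight 1) b] `<=` `]1, +oo[%classic.
  by apply: subset_itv; rewrite bnd_simp//; case: b {hM}.
have L1b : L1 [set` Interval (BRight 1) b] (integrand alpha nu f r).
  apply: (eq_L1 _ (fun t => (t `^ p * bessel_j alpha (r * t))%:C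
    * ((t `^ (nu - alpha - 1 / 2))%:C * f t))).
    move=> t /sub1; rewrite /= in_itv/= andbT => t1.
    by rewrite weighted_integrand// (lt_trans ltr01).
  apply: (L1Z_bounded _ _ _ M); [exact: measurable_itv| |exact: hM|]; last first.
    exact: (sub_L1 _ _ _ (measurable_itv _) (measurable_itv _) sub1 hoo).
  apply: measurable_funM.
    by apply: measurable_funTS; exact: measurable_powR.
  apply: measurable_bessel_j => // t /sub1; rewrite /= in_itv/= andbT => t1.
  by rewrite ltW// (lt_trans ltr01).
(* The point 1 lies in neither interval of the hypotheses and is added as a null set. *)
have L01' : L1 (`]0, 1[ `|` [set 1]) (integrand alpha nu f r).
  by apply: L1_setU => //; exact: L1_set1.
have := L1_setU _ _ _ _ _ L01' L1b.
move=> /(_ (measurableU _ _ (measurable_itv _) (measurable_set1 _)) (measurable_itv _)).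
apply: sub_L1 => //.
  by apply: measurableU; [apply: measurableU|exact: measurable_itv].
move=> t; rewrite /= !itv_boundlr/= !bnd_simp => /andP[t0 tb].
have [t1|t1|->] := ltgtP t 1; [left; left|right|left; right] => //=.
by rewrite t0.
Qed.

(** The bound on [t^p j_alpha] may depend on [N], so [r = 0], where there is no decay, is
    included. *)
Lemma integrand_L1_bounded (r N : R) : 0 <= r ->
  L1 `]0, N[ (integrand alpha nu f r).
Proof.
move=> r0; have [C C0 hC] := bessel_j_bound alpha halpha.
apply: (integrand_L1 _ (N `^ p * C)) => // t.
rewrite in_itv/= => /andP[t1 tN]; have t0 := lt_trans ltr01 t1.
rewrite normrM ler_pM//.
  by rewrite ger0_norm ?powR_ge0// ge0_ler_powR// ?nnegrE ltW// (lt_trans t0).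
by have [] := hC (r * t) (mulr_ge0 r0 (ltW t0)).
Qed.

(** For [0 < r], divide [(r t)^p |j_alpha (r t)| <= C] by [r^p]. For [p = 0] plain boundedness
    suffices, also at [r = 0], since [powR] gives [0^0 = 1]. *)
Lemma bessel_j_scaled_bound : exists2 C : R, 0 < C & forall r t : R,
  0 <= r -> (0 < r \/ p = 0) -> 0 < t ->
  `|t `^ p * bessel_j alpha (r * t)| <= C * r `^ (- p).
Proof.
have [C C0 hC] := bessel_j_bound alpha halpha.
exists C => // r t r0 rp t0; have [jC jCz] := hC _ (mulr_ge0 r0 (ltW t0)).
rewrite normrM ger0_norm ?powR_ge0//.
case: rp => [r_gt0|p0]; last by rewrite p0 oppr0 !powRr0 mul1r mulr1.
have := jCz (mulr_gt0 r_gt0 t0); rewrite -/p powRM// ?(ltW t0)// !powRN => h.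
by rewrite mulrC -ler_pdivlMr ?powR_gt0// -mulrA.
Qed.

Definition weighted_tail (N : R) : R := \int[@lebesgue_measure R]_(t in `[N, +oo[)
  normc ((t `^ (nu - alpha - 1 / 2))%:C * f t).

Lemma weighted_tail_cvg0 : weighted_tail N @[N --> +oo] --> (0 : R).
Proof.
apply: tail_integral_cvg0; first by move=> t; exact: normc_ge0.
exact: L1_integrable_normc.
Qed.

Lemma partial_transform_tail : exists2 C : R, 0 < C & forall r : R,
  0 <= r -> [\/ 0 < r, p = 0 | mu + nu != 0] -> exists L, forall N, 1 < N ->
  normc (L - partial_transform alpha nu mu f N r) <=
  C * (r `^ (mu + nu) * r `^ (- p)) * weighted_tail N.
Proof.
have [C C0 hC] := bessel_j_scaled_bound.
exists (2 * C); first by rewrite mulr_gt0.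
move=> r r0 rp; pose I := integrand alpha nu f r.
have T0 N : 0 <= weighted_tail N by apply: Rintegral_ge0 => t _; exact: normc_ge0.
(* In the first case [powR] makes the prefactor 0, so every partial transform vanishes; in the
   second the scaled bound applies and [L] comes from the integral over the half-line. *)
have [[r_eq0 mn0]|{}rp] : (r = 0 /\ mu + nu != 0) \/ (0 < r \/ p = 0).
  case: rp => [?|?|mn0]; [by right; left|by right; right|].
  by move: r0; rewrite le_eqVlt => /predU1P[<-|]; [left|right; left].
  exists 0 => N _; rewrite /partial_transform r_eq0 powR0// mul0r subr0.
  by rewrite ComplexField.Normc.normc0 mul0r mulr0 mul0r.
have LI : L1 `]0, +oo[ I.
  apply: (integrand_L1 _ (C * r `^ (- p))) => // t.
  by rewrite in_itv/= andbT => t1; apply: hC => //; rewrite (lt_trans ltr01).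
exists ((r `^ (mu + nu))%:C * cintegral `]0, +oo[ I) => N N1.
have N0 := lt_trans ltr01 N1.
have UE : (`]0, +oo[%classic : set R) = `]0, N[ `|` `[N, +oo[.
  by rewrite -itv_bndbnd_setU// bnd_simp ltW.
have LN : L1 `[N, +oo[ I.
  apply: sub_L1 LI => // t; rewrite /= !in_itv/= !andbT; exact: lt_le_trans.
rewrite UE cintegral_setU//; last 2 first.
- apply/disj_setPS => t []; rewrite /= !in_itv/= => /andP[_ tN] /andP[Nt _].
  by have := lt_le_trans tN Nt; rewrite ltxx.
- by rewrite -UE.
rewrite /partial_transform -/I -mulrBr addrAC subrr add0r normcZ.
rewrite ger0_norm ?powR_ge0//.
have -> : 2 * C * (r `^ (mu + nu) * r `^ (- p)) * weighted_tail N =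
    r `^ (mu + nu) * (2 * (C * r `^ (- p) * weighted_tail N)) by ring.
rewrite ler_wpM2l ?powR_ge0// (le_trans (normc_cintegral_le _ _ _ LN))//.
have iT : (@lebesgue_measure R).-integrable `[N, +oo[
    (EFin \o (fun t => normc ((t `^ (nu - alpha - 1 / 2))%:C * f t))).
  apply: L1_integrable_normc; first exact: measurable_itv.
  apply: (sub_L1 _ _ _ (measurable_itv _) (measurable_itv _) _ hoo) => t.
  by rewrite /= !in_itv/= !andbT; exact: lt_le_trans.
rewrite ler_pM2l// /weighted_tail -RintegralZl//.
apply: le_Rintegral => //.
- exact: L1_integrable_normc.
- exact: (integrableZl _ (C * r `^ (- p)) iT).
move=> t; rewrite /= in_itv/= andbT => Nt; have t0 := lt_le_trans N0 Nt.
rewrite /I weighted_integrand// normcZ ler_wpM2r ?normc_ge0//.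
exact: hC.
Qed.

(* At [r = 0], either the factor [r^(mu + nu)] vanishes or [p = 0], in which case
   the bound on the tail holds without decay of [j_alpha]. *)
Lemma transform_uniform (E : set R) (B : R) :
  (forall r, E r -> 0 <= r /\ [\/ 0 < r, p = 0 | mu + nu != 0]) ->
  (forall r, E r -> r `^ (mu + nu) * r `^ (- p) <= B) ->
  (forall r, E r -> transform_converges_at alpha nu mu f r) /\
  transform_converges_uniformly_on alpha nu mu f E.
Proof.
move=> hE hB; have [C C0 hC] := partial_transform_tail.
have T0 : C * B * weighted_tail N @[N --> +oo] --> (0 : R).
  by rewrite -(mulr0 (C * B)); apply: cvgM; [exact: cvg_cst|exact: weighted_tail_cvg0].
have hL r : E r -> exists L, forall N, 1 < N ->
    normc (L - partial_transform alpha nu mu f N r) <= C * B * weighted_tail N.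
  move=> Er; have [r0 rp] := hE _ Er; have [L hL] := hC _ r0 rp.
  exists L => N N1; apply: (le_trans (hL N N1)).
  rewrite ler_wpM2r//; last by rewrite ler_pM2l// hB.
  by apply: Rintegral_ge0 => t _; exact: normc_ge0.
have [cv ucv] := uniform_cvg_lim (partial_transform alpha nu mu f) E _ T0 hL.
have LN r N : E r -> 0 < N -> L1 `]0, N[ (integrand alpha nu f r).
  by move=> /hE[r0 _] _; exact: integrand_L1_bounded.
split=> [r Er|]; split=> //; last exact: cv.
by move=> N; exact: LN.
Qed.

End HankelTransform.

(** * Pointwise convergence and the three regimes of the exponent *)

Theorem proposition3p1 (R : realType) (alpha nu mu : R) (f : R -> R[i])
    (halpha : - (1 / 2) <= alpha)
    (hBV : locally_BV f)
    (hloc : locally_L1 f)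
    (h0 : L1 `]0, 1[ (fun t => (t `^ nu)%:C * f t))
    (hoo : L1 `]1, +oo[ (fun t => (t `^ (nu - alpha - 1 / 2))%:C * f t)) :
  [/\ forall r, 0 < r -> transform_converges_at alpha nu mu f r,
      mu + nu - alpha - 1 / 2 < 0 -> forall e, 0 < e ->
        transform_converges_uniformly_on alpha nu mu f `[e, +oo[,
      0 < mu + nu - alpha - 1 / 2 -> forall e, 0 < e ->
        transform_converges_uniformly_on alpha nu mu f `[0, e] &
      mu + nu - alpha - 1 / 2 = 0 ->
        transform_converges_uniformly_on alpha nu mu f `[0, +oo[].
Proof.
set q := mu + nu - alpha - 1 / 2.
have p0 : 0 <= alpha + 1 / 2 by move: halpha; lra.
have hU := @transform_uniform R alpha nu mu f halpha h0 hoo.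
have powq (r : R) : 0 < r ->
    r `^ (mu + nu) * r `^ (- (alpha + 1 / 2)) = r `^ q.
  move=> r0; rewrite -powRD; last by apply/implyP => _; rewrite gt_eqF.
  by congr powR; rewrite /q; ring.
split.
(* Pointwise convergence is the case of a singleton, where [r^q] is its own bound. *)
- move=> r r0; have [] := hU [set r] (r `^ q); last by move=> + _; exact.
  + by move=> _ ->; split; [exact: ltW|exact: Or31].
  + by move=> _ ->; rewrite powq.
- move=> q0 e e0; apply: (proj2 (hU _ (e `^ q) _ _)) => r;
    rewrite /= in_itv/= andbT => er; have r0 := lt_le_trans e0 er.
    by split; [exact: ltW|exact: Or31].
  (* For [q < 0] the power decreases, so its largest value on the ray is [e^q]. *)
  have qE (x : R) : x `^ q = (x `^ (- q))^-1 by rewrite powRN invrK.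
  rewrite powq// 2!qE lef_pV2 ?posrE ?powR_gt0//.
  by apply: ge0_ler_powR; rewrite ?nnegrE ?oppr_ge0// ltW.
(* Here [mu + nu > alpha + 1/2 >= 0], so the prefactor vanishes at [r = 0]. *)
- move=> q0 e e0; have mn0 : mu + nu != 0.
    by rewrite gt_eqF//; move: q0; rewrite /q; lra.
  apply: (proj2 (hU _ (e `^ q) _ _)) => r; rewrite /= in_itv/= => /andP[r0 re].
    by split=> //; exact: Or33.
  move: r0; rewrite le_eqVlt => /predU1P[<-|r0].
    by rewrite powR0// mul0r powR_ge0.
  by rewrite powq//; apply: ge0_ler_powR; rewrite ?nnegrE// ltW.
- move=> q0; have mnE : mu + nu = alpha + 1 / 2 by move: q0; rewrite /q; lra.
  apply: (proj2 (hU _ 1 _ _)) => r; rewrite /= in_itv/= andbT => r0.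
    split=> //; have [mn0|mn0] := eqVneq (mu + nu) 0; [|exact: Or33].
    by apply: Or32; rewrite -mnE.
  move: r0; rewrite le_eqVlt => /predU1P[<-|r0].
    (* At [r = 0] the product of powers is [0^0 * 0^0 = 1] if [mu + nu = 0], and 0 otherwise. *)
    rewrite -mnE; have [->|mn0] := eqVneq (mu + nu) 0.
      by rewrite oppr0 powRr0 mulr1.
    by rewrite powR0// mul0r.
  by rewrite powq// q0 powRr0.
Qed.
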